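(* There is a finitely generated solvable group $\Gamma$ such that $W(\Gamma)$ contains (a subgroup isomorphic to) the property $(T)$ group $SL(3,\mathbb{Z})$.
   Context: For a metric space $(X,d)$, the wobbling group $W(X)$ is the group (under composition) of all bijections $g:X\to X$ with $\sup_{x\in X} d(x,g(x))<\infty$. For a finitely generated group $\Gamma$, $W(\Gamma)$ denotes the wobbling group of $\Gamma$ with the word metric associated with a finite generating set (the metric of the corresponding Cayley graph); it does not depend on the choice of the finite generating set. *)

(* Defs.v *)
From HB Require Import structures.
From mathcomp Require Import all_boot all_order all_algebra.
From mathcomp Require Import all_classical all_reals all_analysis.

Set Implicit Arguments.
Unset Strict Implicit.
Unset Printing Implicit Defensive.

Import Order.TTheory GRing.Theory Num.Theory.

Local Open Scope classical_set_scope.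
Local Open Scope group_scope.

Section GroupNotions.
Variable G : groupType.

Definition subgroup (A : set G) : Prop := group_closed [in A].

Definition generated (A : set G) : set G := smallest subgroup A.

Definition generates (S : seq G) : Prop := generated [set` S] = setT.

Definition finitely_generated : Prop := exists S : seq G, generates S.

Fixpoint derived_series (n : nat) : set G :=
  if n is n'.+1 then
    generated [set z | exists x y, [/\ derived_series n' x, derived_series n' y
                                     & z = [~ x, y] ] ]
  else setT.

Definition solvable_group : Prop := exists n, derived_series n = [set 1].

End GroupNotions.

Definition contains_copy_of (G H : groupType) : Prop :=
  exists2 K : set G, subgroup K &
    exists f : {multiplicative H -> G}, set_bij setT K f.

Section WordLength.
Variables (G : groupType) (S : seq G).

Definition is_word (w : seq G) : Prop :=
  {in w, forall y, y \in S \/ y^-1 \in S}.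

Definition expressible (g : G) (n : nat) : Prop :=
  exists w, [/\ is_word w, size w = n & \prod_(y <- w) y = g].

Lemma expressibleM g h m n :
  expressible g m -> expressible h n -> expressible (g * h) (m + n)%N.
Proof.
move=> [w1 [W1 <- <-]] [w2 [W2 <- <-]]; exists (w1 ++ w2); split.
- by move=> y; rewrite mem_cat => /orP[/W1|/W2].
- by rewrite size_cat.
- by rewrite big_cat.
Qed.

Lemma expressible0 : expressible 1 0.
Proof. by exists [::]; rewrite big_nil. Qed.

Lemma expressible1 y : y \in S \/ y^-1 \in S -> expressible y 1.
Proof.
move=> yS; exists [:: y]; split=> //=; last by rewrite big_seq1.
by move=> z; rewrite inE => /eqP ->.
Qed.

Lemma expressibleV g n : expressible g n -> expressible g^-1 n.
Proof.
move=> [w [W <- <-]] {g n}; elim: w W => [|x w IH] W /=.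
  by rewrite big_nil invg1; exact: expressible0.
rewrite big_cons invgM -addn1; apply: expressibleM.
  by apply: IH => y yw; apply: W; rewrite inE yw orbT.
apply: expressible1; rewrite invgK.
by have [|] := W x (mem_head _ _); [right|left].
Qed.

Hypothesis genS : generates S.

Lemma generates_expressible g : exists n, `[< expressible g n >].
Proof.
suff : generated [set` S] `<=` [set g | exists n, expressible g n].
  by move/(_ g); rewrite genS => /(_ I)[n gn]; exists n; apply/asboolP.
move=> x; apply; split; last first.
  by move=> y yS; exists 1%N; apply: expressible1; left.
split; first by rewrite inE; exists 0%N; exact: expressible0.
move=> u v; rewrite !inE => -[m um] [n vn]; exists (m + n)%N.
by apply: expressibleM um _; exact: expressibleV.
Qed.

Definition word_length (g : G) : nat := ex_minn (generates_expressible g).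

Lemma word_lengthP g : expressible g (word_length g).
Proof. by rewrite /word_length; case: ex_minnP => n /asboolP. Qed.

Lemma word_length_le g n : expressible g n -> (word_length g <= n)%N.
Proof. by rewrite /word_length; case: ex_minnP => m _ H /asboolP /H. Qed.

Lemma word_length1 : word_length 1 = 0%N.
Proof. by apply/eqP; rewrite -leqn0 word_length_le//; exact: expressible0. Qed.

Lemma word_length_eq0 g : word_length g = 0%N -> g = 1.
Proof.
by move=> g0; have [w [_ + <-]] := word_lengthP g; rewrite g0 => /size0nil ->; rewrite big_nil.
Qed.

Lemma word_lengthV g : word_length g^-1 = word_length g.
Proof.
have le h : (word_length h^-1 <= word_length h)%N.
  by apply: word_length_le; apply: expressibleV; exact: word_lengthP.
by apply/eqP; rewrite eqn_leq le -{1}[g]invgK le.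
Qed.

Lemma word_lengthM g h :
  (word_length (g * h) <= word_length g + word_length h)%N.
Proof. by apply/word_length_le/expressibleM; exact: word_lengthP. Qed.

End WordLength.

(* The carrier of [G], as a metric space for the word metric of [S], i.e. the
   graph metric of the Cayley graph with edges {g, g s} for s in S. *)
Definition word_space (R : realType) (G : groupType) (S : seq G)
  (genS : generates S) : Type := G.

Section WordMetric.
Context (R : realType) (G : groupType) (S : seq G) (genS : generates S).

Local Notation X := (word_space R genS).

HB.instance Definition _ := Choice.copy X G.

Definition word_dist (x y : X) : R :=
  (word_length genS ((x : G)^-1 * (y : G)))%:R%R.

Lemma word_distxx x : word_dist x x = 0%R.
Proof. by rewrite /word_dist mulVg word_length1. Qed.

Lemma word_dist_positivity x y : word_dist x y = 0%R -> x = y.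
Proof.
move/eqP; rewrite pnatr_eq0 => /eqP/word_length_eq0 xy.
by rewrite -[LHS](mulg1 (x : G)) -xy mulVKg.
Qed.

Lemma word_dist_sym x y : word_dist x y = word_dist y x.
Proof. by rewrite /word_dist -word_lengthV invgM invgK. Qed.

Lemma word_dist_triangle y x z :
  (word_dist x z <= word_dist x y + word_dist y z)%R.
Proof.
rewrite /word_dist -natrD ler_nat.
have -> : (x : G)^-1 * (z : G) = ((x : G)^-1 * (y : G)) * ((y : G)^-1 * (z : G)).
  by rewrite -mulgA mulVKg.
exact: word_lengthM.
Qed.

HB.instance Definition _ := isMetric.Build R X word_distxx
  word_dist_positivity word_dist_sym word_dist_triangle.

End WordMetric.

Section Wobbling.
Context (R : realType) (X : metricType R).

Definition is_wobbling (g : X -> X) : Prop :=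
  bijective g /\ (ereal_sup [set (mdist x (g x))%:E | x in setT] < +oo)%E.

Lemma bounded_displacementP (g : X -> X) :
  (ereal_sup [set (mdist x (g x))%:E | x in setT] < +oo)%E <->
  exists M : R, forall x, (mdist x (g x) <= M)%R.
Proof.
split=> [|[M gM]]; last first.
  apply: (@le_lt_trans _ _ M%:E); last exact: ltry.
  by apply: ge_ereal_sup => _ [x _ <-]; rewrite lee_fin.
set s := ereal_sup _ => s_lt.
have gs x : ((mdist x (g x))%:E <= s)%E.
  by apply: ereal_sup_ubound; exists x.
case: s s_lt gs => [M| |] // _ gs.
- by exists M => x; rewrite -lee_fin.
- by exists 0%R => x; move: (gs x); rewrite leeNy_eq.
Qed.

Lemma is_wobbling_id : is_wobbling id.
Proof.
split; first by exists id.
by apply/bounded_displacementP; exists 0%R => x; rewrite mdistxx.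
Qed.

Lemma is_wobbling_comp f g :
  is_wobbling f -> is_wobbling g -> is_wobbling (f \o g).
Proof.
move=> [bf /bounded_displacementP[M fM]] [bg /bounded_displacementP[N gN]].
split; first exact: bij_comp.
apply/bounded_displacementP; exists (N + M)%R => x /=.
by rewrite (le_trans (metric_triangle _ (g x) _))// lerD.
Qed.

Lemma is_wobbling_can f h :
  cancel f h -> cancel h f -> is_wobbling f -> is_wobbling h.
Proof.
move=> fK hK [_ /bounded_displacementP[M fM]]; split; first by exists f.
apply/bounded_displacementP; exists M => x.
by rewrite metric_sym -{2}[x]hK.
Qed.

Definition wobbling : Type := {g : X -> X | `[< is_wobbling g >]}.

HB.instance Definition _ := Choice.on wobbling.

Definition wobbling_fun (g : wobbling) : X -> X := sval g.

Lemma wobblingP (g : wobbling) : is_wobbling (wobbling_fun g).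
Proof. exact/asboolP/(svalP g). Qed.

Definition mk_wobbling (g : X -> X) (gW : is_wobbling g) : wobbling :=
  exist _ g (introT (asboolP _) gW).

Lemma wobbling_inj (f g : wobbling) : wobbling_fun f = wobbling_fun g -> f = g.
Proof. exact: val_inj. Qed.

Definition wob1 : wobbling := mk_wobbling is_wobbling_id.

Definition wobM (f g : wobbling) : wobbling :=
  mk_wobbling (is_wobbling_comp (wobblingP f) (wobblingP g)).

Lemma wobV_subproof (f : wobbling) : exists h : wobbling,
  cancel (wobbling_fun f) (wobbling_fun h) /\
  cancel (wobbling_fun h) (wobbling_fun f).
Proof.
have [[h fK hK] _] := wobblingP f.
by exists (mk_wobbling (is_wobbling_can fK hK (wobblingP f))).
Qed.

Definition wobV (f : wobbling) : wobbling := sval (cid (wobV_subproof f)).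

Lemma wobMA : associative wobM.
Proof. by move=> f g h; apply: wobbling_inj. Qed.

Lemma wob1M : left_id wob1 wobM.
Proof. by move=> f; apply: wobbling_inj. Qed.

Lemma wobM1 : right_id wob1 wobM.
Proof. by move=> f; apply: wobbling_inj. Qed.

Lemma wobVM : left_inverse wob1 wobV wobM.
Proof.
move=> f; apply: wobbling_inj; apply/funext => x.
by rewrite /wobV; case: cid => h [fK hK] /=; exact: fK.
Qed.

Lemma wobMV : right_inverse wob1 wobV wobM.
Proof.
move=> f; apply: wobbling_inj; apply/funext => x.
by rewrite /wobV; case: cid => h [fK hK] /=; exact: hK.
Qed.

HB.instance Definition _ :=
  isGroup.Build wobbling wobMA wob1M wobM1 wobVM wobMV.

End Wobbling.

Arguments wobbling {R} X.

Section SpecialLinear.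
Context (n : nat) (R : comNzRingType).

Definition SL : Type := {A : 'M[R]_n | (\det A == 1)%R}.

HB.instance Definition _ := Choice.on SL.

Definition mkSL (A : 'M[R]_n) (detA : (\det A == 1)%R) : SL :=
  exist (fun A : 'M[R]_n => (\det A == 1)%R) A detA.

Lemma SL1_subproof : (\det (1%:M : 'M[R]_n) == 1)%R.
Proof. by rewrite det1. Qed.

Lemma SLM_subproof (A B : SL) : (\det (sval A *m sval B) == 1)%R.
Proof. by rewrite det_mulmx (eqP (svalP A)) (eqP (svalP B)) mulr1. Qed.

Lemma SLV_subproof (A : SL) : (\det (\adj (sval A)) == 1)%R.
Proof.
have := congr1 determinant (mul_mx_adj (sval A)).
by rewrite det_mulmx (eqP (svalP A)) mul1r det1 => ->.
Qed.

Definition SL1 : SL := mkSL SL1_subproof.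
Definition SLM (A B : SL) : SL := mkSL (SLM_subproof A B).
(* the adjugate is the inverse when the determinant is 1 *)
Definition SLV (A : SL) : SL := mkSL (SLV_subproof A).

Lemma SLMA : associative SLM.
Proof. by move=> A B C; apply: val_inj; rewrite /= mulmxA. Qed.

Lemma SL1M : left_id SL1 SLM.
Proof. by move=> A; apply: val_inj; rewrite /= mul1mx. Qed.

Lemma SLM1 : right_id SL1 SLM.
Proof. by move=> A; apply: val_inj; rewrite /= mulmx1. Qed.

Lemma SLVM : left_inverse SL1 SLV SLM.
Proof. by move=> A; apply: val_inj; rewrite /= mul_adj_mx (eqP (svalP A)). Qed.

Lemma SLMV : right_inverse SL1 SLV SLM.
Proof. by move=> A; apply: val_inj; rewrite /= mul_mx_adj (eqP (svalP A)). Qed.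

HB.instance Definition _ := isGroup.Build SL SLMA SL1M SLM1 SLVM SLMV.

End SpecialLinear.

Arguments SL n R : clear implicits.

(* Main.v *)
From HB Require Import structures.
Require Import Defs.
From mathcomp Require Import all_boot all_order all_algebra.
From mathcomp Require Import all_classical all_reals all_analysis.
From mathcomp Require Import ring lra.

(** The Lie group SL(3,R) factors as B K with B the solvable group of upper
   triangular matrices and K compact, so it looks like B from far away, and
   SL(3,Z) maps into it.  This B has no lattice, but it sits coarsely inside the
   triangular group over Z[1/2], which is finitely generated and solvable: the
   diagonal is rounded to powers of 2 and the unipotent part to integers.

   In detail, the group is the subgroup [Gamma] of SL(3,Q) generated by diagonal
   matrices [dia a b] with powers of 2 on the diagonal and by elementary
   matrices.  Every x in SL(3,Z) is a product g c with g in [Gamma] of the form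
   dia * uni, where uni is unipotent with integral entries apart from its corner
   (see below), and with the entries of c at most 6 in absolute value ([reduction]: Gram-Schmidt over Q, then
   rounding).  Put phi(x) = g.  For a fixed h, the element
   phi(x)^-1 phi(x h) = c h c'^-1 is bounded independently of x, and it is also
   a product uni * dia * uni with unipotent factors of the same kind.  Boundedness
   controls the powers of 2 in the middle, hence all denominators, so only
   finitely many elements can occur ([finite_uni_dia_uni]).

   The map phi need not be injective, but if phi(x) = phi(y) then x^-1 y = c^-1 c'
   is bounded by an absolute constant, so x and y are distinguished by their
   reduction modulo a fixed integer N.  This reduction, a colour in {0,..,M-1},
   is recorded in the corner of the unipotent factor as a fractional part
   (multiple of 1/M); the generators therefore include an elementary matrix with
   corner 1/M.

   Now SL(3,Z) acts on the image of phi by right translation, and this action,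
   extended by the identity, consists of bijections of [Gamma] with finitely
   many displacements x^-1 g(x).  Finitely many elements have bounded word length
   for any finite generating set, so this is an embedding in the wobbling group
   ([wobbling_contains]).  Solvability is seen on matrix entries
   ([upper_solvable]). *)

Set Implicit Arguments.
Unset Strict Implicit.
Unset Printing Implicit Defensive.

Import Order.TTheory GRing.Theory Num.Theory.

Local Open Scope classical_set_scope.
Local Open Scope ring_scope.

(** * Subgroups and the derived series *)

Section Subgroups.
Local Open Scope group_scope.
Variable G : groupType.
Implicit Types A K : set G.

Lemma subgroupP K : subgroup K <-> K 1 /\ forall u v, K u -> K v -> K (u * v^-1).
Proof.
split=> [[K1 KB]|[K1 KB]].
  split; first by move: K1; rewrite inE.
  by move=> u v Ku Kv; have := KB u v; rewrite !inE; apply.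
split; first by rewrite inE.
by move=> u v; rewrite !inE; apply: KB.
Qed.

Lemma subgroup1 K : subgroup K -> K 1.
Proof. by move=> /subgroupP[]. Qed.

Lemma subgroupF K u v : subgroup K -> K u -> K v -> K (u * v^-1).
Proof. by move=> /subgroupP[_]; apply. Qed.

Lemma subgroupV K u : subgroup K -> K u -> K u^-1.
Proof.
by move=> sK Ku; rewrite -[u^-1]mul1g; apply: subgroupF => //; exact: subgroup1.
Qed.

Lemma subgroupM K u v : subgroup K -> K u -> K v -> K (u * v).
Proof.
by move=> sK Ku Kv; rewrite -[v]invgK; apply: subgroupF => //; exact: subgroupV.
Qed.

Lemma subgroup_generated A : subgroup (generated A).
Proof.
apply/subgroupP; split=> [K [/subgroup1]//|u v uA vA K KA].
by apply: subgroupF; [exact: KA.1|exact: uA|exact: vA].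
Qed.

Lemma subgroup_int K (f : int -> G) : subgroup K ->
  (forall m n, f (m + n)%R = f m * f n) -> K (f 1%R) -> forall m, K (f m).
Proof.
move=> sK fD f1.
have f0 : f 0%R = 1 by apply: (mulgI (f 0%R)); rewrite -fD addr0 mulg1.
have fn (n : nat) : K (f (Posz n)).
  elim: n => [|n IH]; first by rewrite f0; exact: subgroup1.
  by rewrite intS fD; exact: subgroupM.
case=> [n|n]; first exact: fn.
rewrite NegzE; suff -> : f (- Posz n.+1)%R = (f (Posz n.+1))^-1 by exact: subgroupV.
by apply: (mulIg (f (Posz n.+1))); rewrite mulVg -fD addNr.
Qed.

(** The commutator enters only as the solution [z] of [x * y = y * x * z], which
   saves computing inverses. *)
Lemma derived_series_step n K K' : derived_series n `<=` K -> subgroup K' ->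
  (forall x y z, K x -> K y -> x * y = y * x * z -> K' z) ->
  derived_series n.+1 `<=` K'.
Proof.
move=> nK sK' KK'; apply: smallest_sub => // z [x [y [xn yn ->]]].
by apply: (KK' x y); [exact: nK|exact: nK|exact: commgC].
Qed.

End Subgroups.

(** * The group generated by a finite list *)

Section GeneratedGroup.
Local Open Scope group_scope.
Variables (G : groupType) (s : seq G).

Definition in_generated : {pred G} := fun x => `[< generated [set` s] x >].

Definition generated_group : Type := {x : G | in_generated x}.

Lemma gen_group_closed : group_closed in_generated.
Proof.
have [g1 gB] := (subgroupP _).1 (subgroup_generated [set` s]).
by split=> [|u v /asboolP ug /asboolP vg]; apply/asboolP; [exact: g1|exact: gB].
Qed.

HB.instance Definition _ := [isSub of generated_group for @sval G in_generated].
HB.instance Definition _ := [Choice of generated_group by <:].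
HB.instance Definition _ :=
  SubChoice_isSubGroup.Build G in_generated generated_group gen_group_closed.

Definition to_generated_group (x : G) (xs : generated [set` s] x) : generated_group :=
  exist _ x (introT (asboolP _) xs).

Lemma generated_groupP (x : generated_group) : generated [set` s] (val x).
Proof. exact/asboolP/(valP x). Qed.

(** The generators are those of the ambient group, read in the subtype.  A
   subgroup of the subtype containing them has as image a subgroup of the ambient
   group, and minimality applies there. *)
Lemma generated_group_fg : finitely_generated generated_group.
Proof.
exists (pmap insub s); apply/seteqP; split=> // x _ K [sK SK].
pose L := [set y | exists2 k : generated_group, K k & val k = y].
have sL : subgroup L.
  apply/subgroupP; split; first by exists 1; [exact: subgroup1|].
  move=> _ _ [k Kk <-] [l Kl <-]; exists (k * l^-1) => //.
  exact: subgroupF.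
have sSL : [set` s] `<=` L.
  move=> y ys; have yg : generated [set` s] y by exact: sub_gen_smallest.
  exists (to_generated_group yg) => //; apply: SK.
  by rewrite /= mem_pmap_sub.
have [k Kk /val_inj <-//] := generated_groupP x (conj sL sSL).
Qed.

End GeneratedGroup.

(** * Translations along an embedded set *)

Section Wobble.
Local Open Scope group_scope.
Variables (R : realType) (G : groupType) (S : seq G) (genS : generates S).

(** A finite set of displacements suffices for every word metric at once, since
   any generating set gives finitely many elements bounded length. *)
Lemma finite_displacement (g : word_space R genS -> word_space R genS) :
  bijective g -> finite_set [set (x : G)^-1 * (g x : G) | x in setT] ->
  is_wobbling g.
Proof.
move=> bg /finite_seqP[s sE]; split => //; apply/bounded_displacementP.
exists (\max_(y <- s) word_length genS y)%:R%R => x.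
change (word_dist x (g x) <= (\max_(y <- s) word_length genS y)%:R :> R)%R.
rewrite /word_dist ler_nat; apply: leq_bigmax_seq => //.
by have : [set` s] ((x : G)^-1 * (g x : G)) by rewrite -sE; exists x.
Qed.

Variables (H : groupType) (phi : H -> G).
Hypothesis phiI : injective phi.
Hypothesis phiF :
  forall h, finite_set [set (phi x)^-1 * phi (x * h) | x in setT].

(** Right translation carried over by [phi]; the inverse makes it a left action,
   and points off the image of [phi] stay in place. *)
Definition push (h : H) (z : word_space R genS) : word_space R genS :=
  if pselect (exists x, phi x = z) is left e then phi (sval (cid e) * h^-1)
  else z.

Lemma push_phi h x : push h (phi x) = phi (x * h^-1).
Proof.
rewrite /push; case: pselect => [e|[]]; last by exists x.
by case: cid => y /= /phiI ->.
Qed.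

Lemma push_out h z : ~ (exists x, phi x = z) -> push h z = z.
Proof. by rewrite /push; case: pselect. Qed.

Lemma pushM g h z : push (g * h) z = push g (push h z).
Proof.
have [[x <-]|nz] := pselect (exists x, phi x = z).
  by rewrite !push_phi invgM mulgA.
by rewrite !push_out.
Qed.

Lemma push1 z : push 1 z = z.
Proof.
have [[x <-]|nz] := pselect (exists x, phi x = z); last by rewrite push_out.
by rewrite push_phi invg1 mulg1.
Qed.

Lemma push_wobbling h : is_wobbling (push h).
Proof.
apply: finite_displacement.
  by exists (push h^-1) => z; rewrite -pushM (mulVg, mulgV) push1.
apply: sub_finite_set (_ : _ `<=` [set 1] `|` _) _; last first.
  by rewrite finite_setU; split; [exact: finite_set1|exact: (phiF h^-1)].
move=> _ [z _ <-]; have [[x <-]|nz] := pselect (exists x, phi x = z).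
  by right; exists x; rewrite ?push_phi.
by left; rewrite push_out//= mulVg.
Qed.

Definition wobble (h : H) : wobbling (word_space R genS) :=
  mk_wobbling (push_wobbling h).

Lemma wobbleM : {morph wobble : g h / g * h}.
Proof. by move=> g h; apply: wobbling_inj; apply/funext => z; exact: pushM. Qed.

HB.instance Definition _ := isMultiplicative.Build _ _ wobble wobbleM.

Lemma wobble_inj : injective wobble.
Proof.
move=> g h /(congr1 (fun w => wobbling_fun w (phi 1 : word_space R genS))) /=.
by rewrite /wobble /= !push_phi !mul1g => /phiI/invg_inj.
Qed.

(** [H] acts by right translations because word metrics are left invariant: it is
   right multiplication that moves points by a bounded amount. *)
Lemma wobbling_contains : contains_copy_of (wobbling (word_space R genS)) H.
Proof.
exists (range wobble); last first.
  exists wobble; split=> //; by move=> g h _ _; exact: wobble_inj.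
have w1 : wobble 1 = 1.
  by apply: (mulgI (wobble 1)); rewrite -wobbleM !mulg1.
apply/subgroupP; split; first by exists 1.
move=> _ _ [g _ <-] [h _ <-]; exists (g * h^-1) => //.
rewrite wobbleM; congr (_ * _); apply: (mulIg (wobble h)).
by rewrite -wobbleM !mulVg w1.
Qed.

End Wobble.

(** * Triangular 3 x 3 matrices *)

Local Notation i0 := (@Ordinal 3 0 isT).
Local Notation i1 := (@Ordinal 3 1 isT).
Local Notation i2 := (@Ordinal 3 2 isT).

Lemma forall_ord3 (P : 'I_3 -> Prop) : P i0 -> P i1 -> P i2 -> forall i, P i.
Proof.
move=> P0 P1 P2 [[|[|[|//]]] lt3].
- by have -> : Ordinal lt3 = i0 by exact: val_inj.
- by have -> : Ordinal lt3 = i1 by exact: val_inj.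
- by have -> : Ordinal lt3 = i2 by exact: val_inj.
Qed.

Lemma sum_ord3 (V : nmodType) (F : 'I_3 -> V) : \sum_i F i = F i0 + F i1 + F i2.
Proof.
rewrite 3!big_ord_recl big_ord0 addr0 addrA.
by congr (F _ + F _ + F _); exact: val_inj.
Qed.

Section Matrices3.
Variable F : comNzRingType.
Implicit Types A B : 'M[F]_3.

Lemma mulmx3 A B i j :
  (A *m B) i j = A i i0 * B i0 j + A i i1 * B i1 j + A i i2 * B i2 j.
Proof. by rewrite mxE sum_ord3. Qed.

Lemma det3 A : \det A =
    A i0 i0 * (A i1 i1 * A i2 i2 - A i1 i2 * A i2 i1)
  - A i0 i1 * (A i1 i0 * A i2 i2 - A i1 i2 * A i2 i0)
  + A i0 i2 * (A i1 i0 * A i2 i1 - A i1 i1 * A i2 i0).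
Proof.
pose a (i j : nat) : F := A (inord i) (inord j).
have aE (i j : 'I_3) : A i j = a i j by rewrite /a !inord_val.
rewrite (expand_det_row _ i0) sum_ord3 /cofactor.
rewrite !(expand_det_row _ ord0) !big_ord_recl !big_ord0 /cofactor.
rewrite !det_mx11 !mxE !aE /= /bump /= !addn0 /=.
ring.
Qed.

Definition mx3 a b c d e f g h k : 'M[F]_3 :=
  \matrix_(i, j) nth 0 (nth [::] [:: [:: a; b; c]; [:: d; e; f]; [:: g; h; k]] i) j.

End Matrices3.

Section Triangular.
Variable F : fieldType.
Implicit Types A B C : 'M[F]_3.

Definition upper A := [/\ A i1 i0 = 0, A i2 i0 = 0 & A i2 i1 = 0].

Lemma mulmx_upper A B : upper A -> upper B ->
  [/\ (A *m B) i0 i0 = A i0 i0 * B i0 i0, (A *m B) i1 i1 = A i1 i1 * B i1 i1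
    & (A *m B) i2 i2 = A i2 i2 * B i2 i2] /\
  (A *m B) i0 i1 = A i0 i0 * B i0 i1 + A i0 i1 * B i1 i1 /\
  (A *m B) i1 i2 = A i1 i1 * B i1 i2 + A i1 i2 * B i2 i2.
Proof.
move=> [A10 A20 A21] [B10 B20 B21].
by split; [split|split]; rewrite mulmx3 ?A10 ?A20 ?A21 ?B10 ?B20 ?B21; ring.
Qed.

Lemma det_upper A : upper A -> \det A = A i0 i0 * A i1 i1 * A i2 i2.
Proof. by move=> [A10 A20 A21]; rewrite det3 A10 A20 A21; ring. Qed.

Lemma upper_diag_neq0 (x : SL 3 F) : upper (sval x) ->
  [/\ sval x i0 i0 != 0, sval x i1 i1 != 0 & sval x i2 i2 != 0].
Proof.
move=> /det_upper; rewrite (eqP (svalP x)) => dx.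
by split; apply: contra_eq_neq dx => ->; rewrite ?mul0r ?mulr0 ?mul0r oner_neq0.
Qed.

(** Down the derived series, first the diagonal becomes trivial, then the two
   entries next to it, then the corner.  An embedding [f] takes the place of an
   inclusion because subgroups are types of their own. *)
Lemma upper_solvable (G : groupType) (f : G -> SL 3 F) :
  {morph f : x y / (x * y)%g} -> injective f -> (forall x, upper (sval (f x))) ->
  solvable_group G.
Proof.
move=> fM fI fU.
have fE x y z : (x * y = z)%g -> sval (f x) *m sval (f y) = sval (f z).
  by move=> <-; rewrite fM.
pose K1 := [set x | [/\ sval (f x) i0 i0 = 1, sval (f x) i1 i1 = 1
                      & sval (f x) i2 i2 = 1]].
pose K2 := [set x | K1 x /\ sval (f x) i0 i1 = 0 /\ sval (f x) i1 i2 = 0].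
have f1 : f 1%g = 1%g.
  by apply: (mulgI (f 1%g)); rewrite -fM !mulg1.
(* the entries of a quotient are found by solving [w * v = u] *)
have sK1 : subgroup K1.
  apply/subgroupP; split; first by rewrite /K1 /= f1 /= !mxE.
  move=> u v [u0 u1 u2] [v0 v1 v2].
  have [[]] := mulmx_upper (fU (u * v^-1)%g) (fU v).
  rewrite (fE _ _ _ (mulgVK v u)) u0 u1 u2 v0 v1 v2 !mulr1 => h0 h1 h2 _.
  by split.
have sK2 : subgroup K2.
  apply/subgroupP; split; first by split; [exact: subgroup1|rewrite f1 /= !mxE].
  move=> u v [Ku [u01 u12]] [Kv [v01 v12]].
  have [w0 w1 w2] := subgroupF sK1 Ku Kv; split=> //.
  have [_ []] := mulmx_upper (fU (u * v^-1)%g) (fU v).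
  case: Kv => v0 v1 v2.
  rewrite (fE _ _ _ (mulgVK v u)) u01 u12 v01 v12 v1 v2 !mulr0 !add0r !mulr1.
  by move=> h0 h1.
have sub1 : derived_series (G := G) 1 `<=` K1.
  apply: (@derived_series_step _ 0 setT) => // x y z _ _ xyz.
  have [[a0 a1 a2] _] := mulmx_upper (fU x) (fU y).
  have [[b0 b1 b2] _] := mulmx_upper (fU y) (fU x).
  have [[c0 c1 c2] _] := mulmx_upper (fU (y * x)%g) (fU z).
  move: c0 c1 c2.
  rewrite (fE _ _ _ (esym xyz)) fM /= a0 a1 a2 fM /= b0 b1 b2.
  have [x0 x1 x2] := upper_diag_neq0 (fU x).
  have [y0 y1 y2] := upper_diag_neq0 (fU y).
  have cancel (a b c : F) : a != 0 -> b != 0 -> a * b = b * a * c -> c = 1.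
    move=> an bn; rewrite [a * b]mulrC -{1}[b * a]mulr1.
    by move/mulfI => -> //; rewrite mulf_neq0.
  move=> c0 c1 c2; split; [exact: cancel c0|exact: cancel c1|exact: cancel c2].
have sub2 : derived_series (G := G) 2 `<=` K2.
  apply: (@derived_series_step _ 1 K1) => // x y z [x0 x1 x2] [y0 y1 y2] xyz.
  have [[a0 a1 a2] [a01 a12]] := mulmx_upper (fU x) (fU y).
  have [[b0 b1 b2] [b01 b12]] := mulmx_upper (fU y) (fU x).
  have [[c0 c1 c2] [c01 c12]] := mulmx_upper (fU (y * x)%g) (fU z).
  move: c0 c1 c2 c01 c12.
  rewrite (fE _ _ _ (esym xyz)) !fM /= a0 a1 a2 b0 b1 b2 a01 a12 b01 b12.
  rewrite x0 x1 x2 y0 y1 y2 !(mulr1, mul1r) => c0 c1 c2.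
  rewrite -c1 -c2 !mulr1 => c01 c12; split; first by split.
  have cancel (a b c : F) : a + b = c + (b + a) -> c = 0.
    by rewrite [a + b]addrC -{1}[b + a]add0r => /addIr.
  by split; [exact: cancel c01|exact: cancel c12].
have sub3 : derived_series (G := G) 3 `<=` [set 1%g].
  have s1 : subgroup [set 1%g : G].
    by apply/subgroupP; split=> // u v -> ->; rewrite /= mulgV.
  apply: (@derived_series_step _ 2 K2) => // x y z.
  move=> [[x0 x1 x2] [x01 x12]] [[y0 y1 y2] [y01 y12]] xyz.
  suff yx : (x * y = y * x)%g by move: xyz; rewrite yx -{1}[(y * x)%g]mulg1 => /mulgI.
  have [x10 x20 x21] := fU x; have [y10 y20 y21] := fU y.
  apply/fI/val_inj; rewrite !fM /=; apply/matrixP.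
  apply: forall_ord3; apply: forall_ord3; rewrite !mulmx3 ?x10 ?x20 ?x21 ?y10 ?y20 ?y21;
    rewrite ?x0 ?x1 ?x2 ?x01 ?x12 ?y0 ?y1 ?y2 ?y01 ?y12; ring.
exists 3; apply/seteqP; split=> // _ ->.
exact: (subgroup1 (subgroup_generated _)).
Qed.

(** Triangularity passes to inverses, so a triangular generating set suffices. *)
Lemma generated_upper (s : seq (SL 3 F)) :
  (forall x, x \in s -> upper (sval x)) ->
  generated [set` s] `<=` [set x | upper (sval x)].
Proof.
move=> sU; apply: smallest_sub => //; apply/subgroupP; split.
  by rewrite /upper /= !mxE.
move=> u v [u10 u20 u21] vU; have [v0 v1 v2] := upper_diag_neq0 vU.
case: vU => v10 v20 v21; set w := (u * v^-1)%g.
have wv i j : sval u i j = (sval w *m sval v) i j.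
  by rewrite -[in LHS](mulgVK v u).
have w10 : sval w i1 i0 = 0.
  move: u10; rewrite wv mulmx3 v10 v20 !mulr0 !addr0 => /eqP.
  by rewrite mulf_eq0 (negbTE v0) orbF => /eqP.
have w20 : sval w i2 i0 = 0.
  move: u20; rewrite wv mulmx3 v10 v20 !mulr0 !addr0 => /eqP.
  by rewrite mulf_eq0 (negbTE v0) orbF => /eqP.
split=> //; move: u21; rewrite wv mulmx3 v21 w20 mul0r mulr0 add0r addr0 => /eqP.
by rewrite mulf_eq0 (negbTE v1) orbF => /eqP.
Qed.

End Triangular.

(** * The solvable group *)

Section Gamma.

Lemma uni_subproof (p q r : rat) : \det (mx3 1 p r 0 1 q 0 0 1) == 1.
Proof. by rewrite det3 !mxE /=; apply/eqP; ring. Qed.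

Definition uni p q r : SL 3 rat := mkSL (uni_subproof p q r).

Lemma exp2D (a b : int) : 2 ^ (a + b) = 2 ^ a * 2 ^ b :> rat.
Proof. by rewrite expfzDr. Qed.

Lemma dia_subproof (a b : int) :
  \det (mx3 (2 ^ a) 0 0 0 (2 ^ b) 0 0 0 (2 ^ (- (a + b)))  : 'M[rat]_3) == 1.
Proof.
rewrite det3 !mxE /= !(mulr0, mul0r, subr0, addr0) mulrA -!exp2D.
by rewrite addrN expr0z.
Qed.

Definition dia a b : SL 3 rat := mkSL (dia_subproof a b).

Lemma uniM p q r p' q' r' :
  (uni p q r * uni p' q' r')%g = uni (p + p') (q + q') (r + p * q' + r').
Proof.
apply/val_inj/matrixP; apply: forall_ord3; apply: forall_ord3;
  rewrite mulmx3 !mxE /=; ring.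
Qed.

Lemma uni0 : uni 0 0 0 = 1%g.
Proof.
apply/val_inj/matrixP.
by apply: forall_ord3; apply: forall_ord3; rewrite !mxE /=.
Qed.

Lemma uniV p q r : (uni p q r)^-1%g = uni (- p) (- q) (p * q - r).
Proof.
apply: (mulgI (uni p q r)); rewrite mulgV uniM -uni0.
by congr (uni _ _ _); ring.
Qed.

Lemma diaM a b a' b' : (dia a b * dia a' b')%g = dia (a + a') (b + b').
Proof.
have E : - (a + a' + (b + b')) = - (a + b) + - (a' + b') by rewrite addrACA opprD.
apply/val_inj/matrixP; apply: forall_ord3; apply: forall_ord3; rewrite mulmx3;
  by rewrite !mxE /= ?E ?exp2D !(mul0r, mulr0, add0r, addr0).
Qed.

Lemma dia0 : dia 0 0 = 1%g.
Proof.
apply/val_inj/matrixP.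
by apply: forall_ord3; apply: forall_ord3; rewrite !mxE /=.
Qed.

Lemma diaV a b : (dia a b)^-1%g = dia (- a) (- b).
Proof. by apply: (mulgI (dia a b)); rewrite mulgV diaM !addrN dia0. Qed.

(** Conjugation by a diagonal matrix rescales the unipotent part; this turns a
   product uni * dia into dia * uni. *)
Lemma uni_dia p q r a b : (uni p q r * dia a b)%g =
  (dia a b * uni (p * 2 ^ (b - a)) (q * 2 ^ (- (a + b) - b)) (r * 2 ^ (- (a + b) - a)))%g.
Proof.
have sub (c d : int) (t : rat) : 2 ^ c * (t * 2 ^ (d - c)) = t * 2 ^ d.
  by rewrite mulrCA -exp2D addrCA subrr addr0.
apply/val_inj/matrixP; apply: forall_ord3; apply: forall_ord3;
  rewrite !mulmx3 !mxE /= ?sub; ring.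
Qed.

Variable M : nat.

Definition gens : seq (SL 3 rat) :=
  [:: dia 1 0; dia 0 1; uni 1 0 0; uni 0 1 0; uni 0 0 M%:R^-1].

Lemma gens_upper x : x \in gens -> upper (sval x).
Proof.
by rewrite !inE => /or4P[|||/orP[]] /eqP ->; split; rewrite !mxE.
Qed.

(** Each family of matrices is a product of one-parameter subgroups indexed by
   the integers. *)
Lemma generated_dia a b : generated [set` gens] (dia a b).
Proof.
have sg := subgroup_generated [set` gens].
rewrite (_ : dia a b = (dia a 0 * dia 0 b)%g); last by rewrite diaM addr0 add0r.
apply: (subgroupM sg).
  apply: (@subgroup_int _ _ (dia^~ 0) sg) => [m n|].
    by rewrite diaM addr0.
  by apply: sub_gen_smallest; rewrite /= !inE eqxx.
apply: (@subgroup_int _ _ (dia 0) sg) => [m n|].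
  by rewrite diaM addr0.
by apply: sub_gen_smallest; rewrite /= !inE eqxx orbT.
Qed.

Lemma generated_uni (p q n : int) :
  generated [set` gens] (uni p%:~R q%:~R (n%:~R / M%:R)).
Proof.
have sg := subgroup_generated [set` gens].
rewrite (_ : uni _ _ _ =
  (uni 0 q%:~R 0 * (uni p%:~R 0 0 * uni 0 0 (n%:~R / M%:R)))%g); last first.
  by rewrite !uniM; congr (uni _ _ _); ring.
have inj m : m \in gens -> generated [set` gens] m.
  exact: (@sub_gen_smallest _ _ [set` gens]).
apply: (subgroupM sg); last apply: (subgroupM sg).
- apply: (@subgroup_int _ _ (fun q => uni 0 q%:~R 0) sg) => [m k|].
    by rewrite uniM intrD; congr (uni _ _ _); ring.
  by apply: inj; rewrite !inE eqxx !orbT.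
- apply: (@subgroup_int _ _ (fun p => uni p%:~R 0 0) sg) => [m k|].
    by rewrite uniM intrD; congr (uni _ _ _); ring.
  by apply: inj; rewrite !inE eqxx !orbT.
- apply: (@subgroup_int _ _ (fun n => uni 0 0 (n%:~R / M%:R)) sg) => [m k|].
    by rewrite uniM intrD; congr (uni _ _ _); ring.
  by apply: inj; rewrite !inE mul1r eqxx !orbT.
Qed.

Definition Gamma := generated_group gens.

Lemma Gamma_solvable : solvable_group Gamma.
Proof.
apply: (@upper_solvable _ _ (val : Gamma -> SL 3 rat)) => [x y||x].
- exact: valM.
- exact: val_inj.
- exact: generated_upper gens_upper _ (generated_groupP x).
Qed.

End Gamma.

(** * Reduction modulo a bounded factor *)

Section Reduction.

Definition dot (A : 'M[rat]_3) (i j : 'I_3) : rat := (A *m A^T) i j.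

Lemma dotE A i j :
  dot A i j = A i i0 * A j i0 + A i i1 * A j i1 + A i i2 * A j i2.
Proof. by rewrite /dot mulmx3 !mxE. Qed.

Lemma dot_gt0 (x : SL 3 rat) i : 0 < dot (sval x) i i.
Proof.
rewrite dotE -!expr2.
have := sqr_ge0 (sval x i i0); have := sqr_ge0 (sval x i i1).
have := sqr_ge0 (sval x i i2) => n2 n1 n0.
rewrite lt_neqAle !addr_ge0 // andbT eq_sym !paddr_eq0 ?addr_ge0 //.
rewrite !sqrf_eq0; apply/negP => /andP[/andP[/eqP x0 /eqP x1] /eqP x2].
have := eqP (svalP x); rewrite (expand_det_row _ i) sum_ord3 x0 x1 x2 !mul0r !addr0.
by move/eqP; rewrite eq_sym oner_eq0.
Qed.

Lemma uni_mul p q r (x : SL 3 rat) j :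
  [/\ sval (uni p q r * x)%g i0 j = sval x i0 j + p * sval x i1 j + r * sval x i2 j,
      sval (uni p q r * x)%g i1 j = sval x i1 j + q * sval x i2 j
    & sval (uni p q r * x)%g i2 j = sval x i2 j].
Proof. by split; rewrite mulmx3 !mxE /=; ring. Qed.

Lemma dot_uni p q r (x : SL 3 rat) (d := dot (sval x)) (d' := dot (sval (uni p q r * x)%g)) :
  [/\ d' i0 i1 = d i0 i1 + p * d i1 i1 + r * d i1 i2 + q * d' i0 i2,
      d' i0 i2 = d i0 i2 + p * d i1 i2 + r * d i2 i2
    & d' i1 i2 = d i1 i2 + q * d i2 i2].
Proof.
rewrite /d /d' !dotE.
have [-> -> ->] := uni_mul p q r x i0; have [-> -> ->] := uni_mul p q r x i1.
by have [-> -> ->] := uni_mul p q r x i2; split; ring.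
Qed.

(** Orthogonal projections of rational vectors are rational, so without
   normalization Gram-Schmidt stays over the rationals. *)
Lemma gram_schmidt (x : SL 3 rat) : exists p q r (w : SL 3 rat),
  [/\ x = (uni p q r * w)%g, dot (sval w) i0 i1 = 0, dot (sval w) i0 i2 = 0
    & dot (sval w) i1 i2 = 0].
Proof.
pose b := - (dot (sval x) i1 i2 / dot (sval x) i2 i2).
pose y := (uni 0 b 0 * x)%g.
have y12 : dot (sval y) i1 i2 = 0.
  have [_ _ ->] := dot_uni 0 b 0 x; have := dot_gt0 x i2.
  by rewrite lt0r /b => /andP[nz _]; field.
pose a := - (dot (sval y) i0 i1 / dot (sval y) i1 i1).
pose c := - (dot (sval y) i0 i2 / dot (sval y) i2 i2).
pose w := (uni a 0 c * y)%g.
have [w01 w02 w12] := dot_uni a 0 c y; rewrite -/w y12 !mul0r !addr0 in w01 w02 w12.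
have w02_0 : dot (sval w) i0 i2 = 0.
  rewrite w02; have := dot_gt0 y i2.
  by rewrite lt0r /c => /andP[nz _]; rewrite mulr0 addr0; field.
have [p [q [r pqr]]] : exists p q r, uni p q r = ((uni a 0 c * uni 0 b 0)^-1)%g.
  by rewrite uniM uniV; do 3 eexists.
exists p, q, r, w; split=> //; first by rewrite pqr invgM -mulgA mulKg mulKg.
rewrite w01; have := dot_gt0 y i1.
by rewrite lt0r /a => /andP[nz _]; rewrite mulr0 addr0; field.
Qed.

(** The Gram matrix of [w] is diagonal of determinant [det w ^ 2]. *)
Lemma dot_prod (w : SL 3 rat) : dot (sval w) i0 i1 = 0 -> dot (sval w) i0 i2 = 0 ->
  dot (sval w) i1 i2 = 0 ->
  dot (sval w) i0 i0 * dot (sval w) i1 i1 * dot (sval w) i2 i2 = 1.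
Proof.
have dotC i j : dot (sval w) i j = dot (sval w) j i by rewrite !dotE; ring.
move=> w01 w02 w12; have : \det (sval w *m (sval w)^T) = 1.
  by rewrite det_mulmx det_tr (eqP (svalP w)) mulr1.
have w10 := w01; have w20 := w02; have w21 := w12; rewrite dotC in w10.
rewrite dotC in w20; rewrite dotC in w21; move: w01 w02 w12 w10 w20 w21.
by rewrite /dot det3 => -> -> -> -> -> -> D; apply: etrans D; ring.
Qed.

(** Applied to a squared norm, this selects a power of 2 within a factor 2 of
   the norm, with no square root taken. *)
Lemma exp2_sandwich (y : rat) : 0 < y ->
  exists k : int, (2 ^ k) ^+ 2 <= y < 4 * (2 ^ k) ^+ 2.
Proof.
move=> y0; pose m := Num.bound y^-1.
have E (n : nat) : 4 ^+ n = (2 ^+ n) ^+ 2 :> rat by rewrite exprAC; congr (_ ^+ n); ring.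
have le24 (n : nat) : 2 ^+ n <= 4 ^+ n :> rat.
  by rewrite E expr2 ler_peMr ?exprn_ge0 // exprn_ege1.
have ym : 1 <= y * 4 ^+ m.
  rewrite -ler_pdivrMl // mulr1; apply: le_trans (le24 m).
  exact/ltW/upper_nthrootP.
(* the shift by [m] makes the search for the exponent a search in [nat] *)
have ex : exists n, y * 4 ^+ m < 4 ^+ n.
  exists (Num.bound (y * 4 ^+ m)); apply: lt_le_trans (le24 _).
  exact: upper_nthrootP.
case: (ex_minnP ex) => -[|n] yn minn; first by move: yn; rewrite expr0 ltNge ym.
have ny : 4 ^+ n <= y * 4 ^+ m.
  by rewrite leNgt; apply/negP => /minn; rewrite ltnn.
exists (n%:Z - m%:Z); rewrite exp2D -invr_expz -!exprnP expr_div_n -!E.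
have m4 : 0 < 4 ^+ m :> rat by rewrite exprn_gt0.
by rewrite ler_pdivrMr // ny /= mulrA ltr_pdivlMr // -exprS.
Qed.

Definition bounded_mx n (K : rat) (A : 'M[rat]_n) := forall i j, `|A i j| <= K.

Lemma scaled_row_bound (t x y z : rat) : t ^+ 2 * (x * x + y * y + z * z) <= 4 ->
  [/\ `|t * x| <= 2, `|t * y| <= 2 & `|t * z| <= 2].
Proof.
move=> t4; have sq (u : rat) : u ^+ 2 <= 4 -> `|u| <= 2.
  by move=> u4; rewrite -(@ler_pXn2r _ 2) ?nnegrE // real_normK ?num_real //; lra.
have := sqr_ge0 (t * x); have := sqr_ge0 (t * y); have := sqr_ge0 (t * z).
by move=> h1 h2 h3; split; apply: sq; nra.
Qed.

(** The Iwasawa decomposition up to a bounded factor: instead of being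
   orthonormal, the rows of [e] are orthogonal of norm at most 2.  The last two are
   scaled to norm between 1 and 2; the determinant forces the scale of the first,
   whose norm is then at most 1 because the three norms have product 1. *)
Lemma iwasawa (x : SL 3 rat) : exists (a b : int) p q r (e : SL 3 rat),
  x = (dia a b * uni p q r * e)%g /\ bounded_mx 2 (sval e).
Proof.
have [p [q [r [w [-> w01 w02 w12]]]]] := gram_schmidt x.
have w012 := dot_prod w01 w02 w12.
have [b /andP[b1 b2]] := exp2_sandwich (dot_gt0 w i1).
have [c /andP[c1 c2]] := exp2_sandwich (dot_gt0 w i2).
pose a := - (b + c).
have cE : - (a + b) = c by rewrite /a; ring.
exists a, b, (p * 2 ^ (b - a)), (q * 2 ^ (c - b)), (r * 2 ^ (c - a)).
exists ((dia a b)^-1 * w)%g; split; first by rewrite -cE -uni_dia -mulgA mulVKg.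
have pos (k : int) : 0 < (2 ^ k) ^+ 2 :> rat by rewrite exprn_gt0 // exprz_gt0.
have abc : (2 ^ a) ^+ 2 * (2 ^ b) ^+ 2 * (2 ^ c) ^+ 2 = 1 :> rat.
  by rewrite -!exprMn -!exp2D -cE subrr expr0z expr1n.
have inv (k : int) : (2 ^ (- k)) ^+ 2 * (2 ^ k) ^+ 2 = 1 :> rat.
  by rewrite -exprMn -exp2D addNr expr0z expr1n.
have a1 : dot (sval w) i0 i0 <= 4 * (2 ^ a) ^+ 2.
  move: (pos a) (pos b) (pos c) (dot_gt0 w i0) w012 abc b1 c1.
  move: (dot _ i0 i0) (dot _ i1 i1) (dot _ i2 i2) => N0 N1 N2.
  move: ((2 ^ a) ^+ 2) ((2 ^ b) ^+ 2) ((2 ^ c) ^+ 2) => A B C pA pB pC pN E1 E2 h1 h2.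
  have BC : B * C <= N1 * N2 by rewrite ler_pM // ltW.
  have : N0 * (B * C) <= A * (B * C).
    by rewrite [A * _]mulrA E2 -E1 -mulrA ler_pM2l.
  by rewrite ler_pM2r ?mulr_gt0 // => h; apply: le_trans h _; rewrite ler_peMl // ltW.
have row_bound (k : int) i : dot (sval w) i i <= 4 * (2 ^ k) ^+ 2 ->
    forall j, `|2 ^ (- k) * sval w i j| <= 2.
  rewrite dotE => h.
  have /scaled_row_bound[h0 h1 h2] : (2 ^ (- k)) ^+ 2 * (sval w i i0 * sval w i i0 +
      sval w i i1 * sval w i i1 + sval w i i2 * sval w i i2) <= 4.
    by apply: le_trans (ler_wpM2l (ltW (pos _)) h) _; rewrite mulrCA inv mulr1.
  exact: forall_ord3.
have scale i j : sval ((dia a b)^-1 * w)%g i j = 2 ^ (- nth c [:: a; b] i) * sval w i j.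
  have cN : - (- a + - b) = - c by rewrite -cE !opprD.
  rewrite diaV /= mulmx3; move: i j; apply: forall_ord3; apply: forall_ord3;
    by rewrite !mxE /= ?cN !mul0r ?addr0 ?add0r.
apply: forall_ord3 => j; rewrite scale; apply: row_bound => //.
- exact: ltW.
- exact: ltW.
Qed.

(** Splitting a unipotent matrix into its integral and fractional parts costs
   only a bounded factor.  The corner may be rounded to any prescribed class [s]
   modulo 1, which leaves room to store information in it. *)
Lemma reduction (x : SL 3 rat) (s : rat) :
  exists (a b p q n : int) (c : SL 3 rat),
    x = (dia a b * uni p%:~R q%:~R (n%:~R + s) * c)%g /\ bounded_mx 6 (sval c).
Proof.
have [a [b [p [q [r [e [-> e2]]]]]]] := iwasawa x.
have fl (t : rat) : exists f, [/\ 0 <= f, f < 1 & t = (Num.floor t)%:~R + f].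
  exists (t - (Num.floor t)%:~R); have := floor_itv t; rewrite intrD => /andP[t0 t1].
  by split; [lra|lra|rewrite addrC subrK].
have [f [f0 f1 pE]] := fl p; have [g [g0 g1 qE]] := fl q.
(* a product of unipotents adds [floor p * g] to the corner *)
have [h [h0 h1 rE]] := fl (r - (Num.floor p)%:~R * g - s).
exists a, b, (Num.floor p), (Num.floor q), (Num.floor (r - (Num.floor p)%:~R * g - s)).
exists (uni f g h * e)%g; split.
  rewrite -!mulgA; congr (_ * _)%g; rewrite mulgA; congr (_ * _)%g.
  by rewrite uniM -pE -qE; congr (uni _ _ _); lra.
have frac (t u : rat) : 0 <= t -> t < 1 -> `|u| <= 2 -> `|t * u| <= 2.
  move=> t0 t1 u2; rewrite normrM (ger0_norm t0).
  by apply: le_trans u2; rewrite ler_piMl // ltW.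
apply: forall_ord3 => j; have [E0 E1 E2] := uni_mul f g h e j; rewrite ?E0 ?E1 ?E2.
- have := ler_normD (sval e i0 j + f * sval e i1 j) (h * sval e i2 j).
  have := ler_normD (sval e i0 j) (f * sval e i1 j).
  have := frac _ _ f0 f1 (e2 i1 j); have := frac _ _ h0 h1 (e2 i2 j).
  have := e2 i0 j; lra.
- have := ler_normD (sval e i1 j) (g * sval e i2 j).
  have := frac _ _ g0 g1 (e2 i2 j); have := e2 i1 j; lra.
- by apply: le_trans (e2 i2 j) _.
Qed.

End Reduction.

(** * Bounded matrices *)

Section Bounds.

Lemma bounded_mulmx n (K L : rat) (A B : 'M[rat]_n) :
  bounded_mx K A -> bounded_mx L B -> bounded_mx (n%:R * (K * L)) (A *m B).
Proof.
move=> AK BL i j; rewrite mxE; apply: le_trans (ler_norm_sum _ _ _) _.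
rewrite mulr_natl -[n in _ *+ n]card_ord -sumr_const; apply: ler_sum => k _.
by rewrite normrM ler_pM.
Qed.

Lemma det_bound n (K : rat) (A : 'M[rat]_n) :
  bounded_mx K A -> `|\det A| <= n`!%:R * K ^+ n.
Proof.
move=> AK; apply: le_trans (ler_norm_sum _ _ _) _.
rewrite mulr_natl -perm.card_Sn -sumr_const.
apply: ler_sum => s _.
rewrite normrM normrX normrN1 expr1n mul1r normr_prod.
rewrite -[n in _ ^+ n]card_ord -prodr_const.
by apply: ler_prod => i _; rewrite normr_ge0 AK.
Qed.

(** For determinant 1 the inverse is the adjugate, whose entries are minors. *)
Lemma bounded_SLV (K : rat) (x : SL 3 rat) :
  bounded_mx K (sval x) -> bounded_mx (2 * K ^+ 2) (sval (x^-1)%g).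
Proof.
move=> xK i j; rewrite /= mxE /cofactor normrM normrX normrN1 expr1n mul1r.
have -> : 2 = 2`!%:R :> rat by [].
by apply: (@det_bound 2 K) => k l; rewrite !mxE.
Qed.

Lemma finite_bounded_mx n (K Q : rat) : 0 < Q ->
  finite_set [set A : 'M[rat]_n |
    bounded_mx K A /\ forall i j, Q * A i j \is a Num.int].
Proof.
move=> Q0.
pose T := [set t : rat | `|t| <= K /\ Q * t \is a Num.int].
have /finite_seqP[s Ts] : finite_set T.
  pose m := Num.bound (Q * K).
  apply: (@sub_finite_set _ _
    (range (fun i : 'I_(m + m).+1 => ((i : nat)%:R - m%:R) / Q))); last first.
    exact: finite_image.
  move=> t [tK /intrP[k kE]].
  have km : `|k%:~R| <= m%:R :> rat.
    rewrite -kE normrM gtr0_norm //; apply: le_trans (_ : Q * K <= _).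
      by rewrite ler_pM2l.
    apply/ltW/archi_boundP; apply: mulr_ge0; first exact: ltW.
    exact: le_trans tK.
  have : 0 <= k + m%:Z <= (m + m)%:Z.
    rewrite -(ler_int rat) -(@ler_int rat (k + _)) intrD PoszD intrD.
    move: km; rewrite ler_norml -!pmulrn; lra.
  case E : (k + m%:Z) => [i|//] /andP[_ im].
  have im' : (i < (m + m).+1)%N by rewrite ltnS.
  exists (Ordinal im') => //=.
  have -> : i%:R - m%:R = k%:~R :> rat.
    by rewrite (_ : k = i%:Z - m%:Z) ?intrB // -E addrK.
  by rewrite -kE mulrAC mulfV ?mul1r // gt_eqF.
have fin : finite_set (range (fun B : 'M['I_(size s)]_n =>
    map_mx (fun k : 'I_(size s) => nth 0 s k) B)) by exact: finite_image.
apply: sub_finite_set fin => A [AK AQ].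
have sA i j : (index (A i j) s < size s)%N.
  by rewrite index_mem; have : [set` s] (A i j) by rewrite -Ts.
exists (\matrix_(i, j) Ordinal (sA i j)) => //; apply/matrixP => i j.
by rewrite !mxE /= nth_index // -index_mem.
Qed.

End Bounds.

(** * A colouring by congruence classes *)

Section Colouring.

Lemma intr_Zp_eq0 (N : nat) (k : int) : (1 < N)%N -> k%:~R = 0 :> 'Z_N ->
  `|k| < N%:Z -> k = 0.
Proof.
move=> N1 kN0 kN; have : `|k|%N%:R = 0 :> 'Z_N.
  by case: k kN0 {kN} => m // /eqP; rewrite NegzE mulrNz oppr_eq0 => /eqP.
move/(congr1 val); rewrite /= val_Zp_nat // modn_small; last by rewrite -ltz_nat abszE.
by move/eqP; rewrite absz_eq0 => /eqP.
Qed.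

(** Reduction modulo [K + 2]: if two matrices are congruent, their quotient minus
   1 has entries divisible by [K + 2], and these entries vanish when they are
   smaller. *)
Lemma separating_colouring (K : nat) : exists (m : nat) (col : SL 3 int -> nat),
  (forall x, (col x < m)%N) /\
  forall x y, col x = col y ->
    (forall i j, `|sval (x^-1 * y)%g i j| <= K%:Z) -> x = y.
Proof.
pose N := K.+2; pose red (x : SL 3 int) : 'M['Z_N]_3 := map_mx intr (sval x).
exists #|{: 'M['Z_N]_3}|, (fun x => nat_of_ord (enum_rank (red x))); split=> [x|x y].
  exact: ltn_ord.
move/ord_inj/enum_rank_inj => xy bxy.
have redM u v : red (u * v)%g = red u *m red v by exact: map_mxM.
have red1 : red (x^-1 * y)%g = 1%:M.
  rewrite redM -xy -redM mulVg; exact: map_mx1.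
suff : (x^-1 * y)%g = 1%g by move/(congr1 (fun z => x * z)%g); rewrite mulVKg mulg1.
apply/val_inj/matrixP => i j; apply/eqP; rewrite -subr_eq0; apply/eqP.
apply: (@intr_Zp_eq0 N) => //.
  have := congr1 (fun A : 'M['Z_N]_3 => A i j) red1; rewrite /red mxE intrB => ->.
  by rewrite !mxE; case: (i == j); rewrite subrr.
apply: le_lt_trans (ler_normB _ _) _.
have /le_lt_trans -> // : `|sval (x^-1 * y)%g i j| + `|sval (1 : SL 3 int)%g i j| <= K%:Z + 1.
  apply: lerD => //; rewrite mxE; by case: (i == j).
by rewrite -PoszD ltz_nat addn1.
Qed.

End Colouring.

(** * Finitely many displacements *)

Section Finiteness.

Lemma bounded_mx_ex n (A : 'M[rat]_n) : exists K, bounded_mx K A.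
Proof.
exists (\sum_i \sum_j `|A i j|) => i j.
rewrite (bigD1 i) //= (bigD1 j) //= -addrA lerDl.
by rewrite addr_ge0 ?sumr_ge0 // => k _; rewrite sumr_ge0.
Qed.

(** The diagonal entries are the powers of 2 in the middle factor.  Each is at
   most [K], and as their product is 1 each is at least [1 / K ^ 2]; so the
   exponents are bounded below, and with them the denominators of all entries. *)
Lemma finite_uni_dia_uni (M : nat) (K : rat) : (0 < M)%N ->
  finite_set [set z : SL 3 rat | bounded_mx K (sval z) /\
    exists a b p q n p' q' n' : int, z =
      (uni p%:~R q%:~R (n%:~R / M%:R)
         * (dia a b * uni p'%:~R q'%:~R (n'%:~R / M%:R)))%g].
Proof.
move=> M0; have Mn : M%:R != 0 :> rat by rewrite pnatr_eq0 -lt0n.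
pose m := Num.bound (K * K).
have fin : finite_set [set A : 'M[rat]_3 | bounded_mx K A /\
    forall i j, 2 ^+ m * M%:R * A i j \is a Num.int].
  by apply: finite_bounded_mx; rewrite mulr_gt0 ?exprn_gt0 ?ltr0n.
have fin' : finite_set ((fun z : SL 3 rat => sval z) @^-1` [set A : 'M[rat]_3 |
    bounded_mx K A /\ forall i j, 2 ^+ m * M%:R * A i j \is a Num.int]).
  by apply: finite_preimage fin => x y _ _ E; exact/val_inj.
apply: sub_finite_set fin' => z0 [zK [a [b [p [q [n [p' [q' [n' zE]]]]]]]]].
move: zK; rewrite zE {z0 zE} => zK; split=> //.
set r := n%:~R / M%:R; set r' := n'%:~R / M%:R.
have Mr : M%:R * r \is a Num.int by rewrite /r mulrCA mulfV // mulr1 intr_int.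
have Mr' : M%:R * r' \is a Num.int by rewrite /r' mulrCA mulfV // mulr1 intr_int.
pose c := - (a + b).
set z := (_ * (_ * _))%g in zK *.
have zE : sval z = mx3 (2 ^ a) (2 ^ a * p'%:~R + p%:~R * 2 ^ b)
    (2 ^ a * r' + p%:~R * (2 ^ b * q'%:~R) + r * 2 ^ c)
    0 (2 ^ b) (2 ^ b * q'%:~R + q%:~R * 2 ^ c) 0 0 (2 ^ c).
  apply/matrixP; apply: forall_ord3; apply: forall_ord3;
    rewrite !mulmx3 !mxE /= -/c -/r -/r';
    move: (2 ^ a) (2 ^ b) (2 ^ c) => A B C; ring.
have pos (k : int) : 0 < 2 ^ k :> rat by exact: exprz_gt0.
have [aK bK cK] : [/\ 2 ^ a <= K, 2 ^ b <= K & 2 ^ c <= K].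
  have := (zK i0 i0, zK i1 i1, zK i2 i2).
  by rewrite zE !mxE /= !gtr0_norm // => -[[]].
(* [2 ^+ m] clears the denominator of any one of the three powers of 2 *)
have den (u v w : int) : u + v + w = 0 -> 2 ^ v <= K -> 2 ^ w <= K ->
    2 ^+ m * 2 ^ u \is a @Num.int rat.
  move=> uvw vK wK.
  have : 2 ^ (- u) < 2 ^ m%:Z :> rat.
    have -> : - u = v + w by apply: (addrI u); rewrite subrr addrA uvw.
    rewrite exp2D; apply: le_lt_trans (_ : K * K < _).
      exact: ler_pM (ltW (pos _)) (ltW (pos _)) vK wK.
    by apply: upper_nthrootP.
  rewrite ltr_eXz2l // => um.
  rewrite exprnP -exp2D; have : 0 <= m%:Z + u by rewrite -lerBlDr sub0r ltW.
  by case: (m%:Z + u) => // k _; rewrite -exprnP rpredX ?natr_int.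
have a_int := den a b c; have b_int := den b c a; have c_int := den c a b.
have {}a_int : 2 ^+ m * 2 ^ a \is a @Num.int rat by apply: a_int => //; rewrite /c; ring.
have {}b_int : 2 ^+ m * 2 ^ b \is a @Num.int rat by apply: b_int => //; rewrite /c; ring.
have {}c_int : 2 ^+ m * 2 ^ c \is a @Num.int rat by apply: c_int => //; rewrite /c; ring.
have pi (k : int) : k%:~R \is a @Num.int rat := intr_int _ k.
have Mi : M%:R \is a @Num.int rat := natr_int _ M.
move: zE a_int b_int c_int => ->; move: (2 ^+ m) (2 ^ a) (2 ^ b) (2 ^ c).
move=> D A B C Ai Bi Ci.
have p0 := pi p; have q0 := pi q; have p1 := pi p'; have q1 := pi q'.
apply: forall_ord3; apply: forall_ord3; rewrite !mxE /= ?mulr0 ?rpred0 //.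
- by rewrite mulrAC rpredM.
- rewrite (_ : _ * _ = (D * A) * M%:R * p'%:~R + (D * B) * M%:R * p%:~R).
    by do ?[assumption | apply: rpredD | apply: rpredM].
  ring.
- rewrite (_ : _ * _ = (D * A) * (M%:R * r') + (D * B) * M%:R * p%:~R * q'%:~R
      + (D * C) * (M%:R * r)).
    by do ?[assumption | apply: rpredD | apply: rpredM].
  ring.
- by rewrite mulrAC rpredM.
- rewrite (_ : _ * _ = (D * B) * M%:R * q'%:~R + (D * C) * M%:R * q%:~R).
    by do ?[assumption | apply: rpredD | apply: rpredM].
  ring.
- by rewrite mulrAC rpredM.
Qed.

End Finiteness.

(** * The embedding of SL(3,Z) *)

Section Embedding.

Lemma SLQ_subproof (x : SL 3 int) : \det (map_mx intr (sval x) : 'M[rat]_3) == 1.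
Proof. by rewrite det_map_mx (eqP (svalP x)). Qed.

Definition SLQ (x : SL 3 int) : SL 3 rat := mkSL (SLQ_subproof x).

Lemma SLQM x y : SLQ (x * y)%g = (SLQ x * SLQ y)%g.
Proof. by apply: val_inj; rewrite /= map_mxM. Qed.

Lemma SLQ_div x y : SLQ (x^-1 * y)%g = ((SLQ x)^-1 * SLQ y)%g.
Proof. by apply: (mulgI (SLQ x)); rewrite -SLQM !mulVKg. Qed.

Lemma dia_uni_corner a b p q r a' b' p' q' r' :
  (dia a b * uni p q r = dia a' b' * uni p' q' r')%g -> r = r'.
Proof.
move=> /(congr1 val) /= E.
have := congr1 (fun A : 'M[rat]_3 => A i0 i0) E.
have := congr1 (fun A : 'M[rat]_3 => A i0 i2) E.
rewrite !mulmx3 !mxE /= !(mul0r, mulr0, mulr1, addr0) => + aa'; rewrite aa'.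
by apply: mulfI; rewrite expfz_neq0.
Qed.

Lemma int_frac_inj (n n' : int) (s s' : rat) : 0 <= s < 1 -> 0 <= s' < 1 ->
  n%:~R + s = n'%:~R + s' -> s = s'.
Proof.
move=> /andP[s0 s1] /andP[s0' s1'] E.
have -> : s = n%:~R + s - (Num.floor (n%:~R + s))%:~R.
  by rewrite (@floor_def _ _ n) ?intrD ?lerDl ?ltrD2l ?s0 //; ring.
rewrite E (@floor_def _ _ n') ?intrD ?lerDl ?ltrD2l ?s0' //; ring.
Qed.

(** Right translation by [h] displaces [phi x] by [c * h * c'^-1], where [c] and
   [c'] are the bounded factors split off from [x] and [x * h]; the splitting
   itself shows that this displacement has the shape uni * dia * uni. *)
Lemma gamma_embedding : exists (M : nat) (phi : SL 3 int -> Gamma M),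
  injective phi /\
  forall h, finite_set [set ((phi x)^-1 * phi (x * h))%g | x in setT].
Proof.
(* 1296 = 3 * (2 * 6 ^ 2) * 6 bounds c^-1 * c' when c and c' are bounded by 6 *)
have [M [col [colM colP]]] := separating_colouring 1296.
have M0 : (0 < M)%N by exact: leq_trans (colM 1%g).
have Mn : M%:R != 0 :> rat by rewrite pnatr_eq0 -lt0n.
pose s x : rat := (col x)%:R / M%:R.
have nE (k : int) z : k%:~R + s z = (k * M%:Z + (col z)%:Z)%:~R / M%:R.
  by rewrite intrD intrM mulrDl mulfK.
have s01 x : 0 <= s x < 1.
  by rewrite divr_ge0 ?ler0n //= ltr_pdivrMr ?ltr0n // mul1r ltr_nat.
(* the corner of the unipotent part carries the colour as its fractional part *)
pose P x (g : Gamma M) := exists (a b p q n : int) (c : SL 3 rat),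
  [/\ val g = (dia a b * uni p%:~R q%:~R (n%:~R + s x))%g,
      SLQ x = (val g * c)%g & bounded_mx 6 (sval c)].
have exP x : exists g, P x g.
  have [a [b [p [q [n [c [xE c6]]]]]]] := reduction (SLQ x) (s x).
  have gG : generated [set` gens M] (dia a b * uni p%:~R q%:~R (n%:~R + s x))%g.
    apply: (subgroupM (subgroup_generated _)); first exact: generated_dia.
    by rewrite nE; exact: generated_uni.
  by exists (to_generated_group gG), a, b, p, q, n, c.
have [phi phiP] := boolp.choice exP.
exists M, phi; split=> [x y xy|h].
  have [a [b [p [q [n [c [xE cE c6]]]]]]] := phiP x.
  have [a' [b' [p' [q' [n' [c' [yE cE' c6']]]]]]] := phiP y.
  have cxy : col x = col y.
    have := etrans (esym xE) (etrans (congr1 val xy) yE).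
    move=> /dia_uni_corner /(int_frac_inj (s01 x) (s01 y)).
    by move/(mulIf _) => /(_ _)/eqP; rewrite invr_eq0 eqr_nat => /(_ Mn)/eqP.
  apply: (colP _ _ cxy) => i j; rewrite -(ler_int rat) intr_norm.
  have E : SLQ (x^-1 * y)%g = (c^-1 * c')%g.
    by rewrite SLQ_div cE cE' xy invgM -mulgA mulKg.
  have := bounded_mulmx (bounded_SLV c6) c6' i j.
  rewrite -[_ *m _]/(sval (c^-1 * c')%g) -E mxE -pmulrn; lra.
have [L hL] := bounded_mx_ex (sval (SLQ h)).
(* the displacement is c * h * c'^-1; here [L] bounds h *)
pose K : rat := 3%:R * (3%:R * (6 * L) * (2 * 6 ^+ 2)).
have fin := finite_uni_dia_uni K M0.
have fin' := finite_preimage (f := (val : Gamma M -> SL 3 rat))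
  (fun x y _ _ => @val_inj _ _ _ x y) fin.
apply: sub_finite_set fin' => _ [x _ <-].
have [a [b [p [q [n [c [xE cE c6]]]]]]] := phiP x.
have [a' [b' [p' [q' [n' [c' [yE cE' c6']]]]]]] := phiP (x * h)%g.
have E : val ((phi x)^-1 * phi (x * h))%g = ((val (phi x))^-1 * val (phi (x * h)%g))%g.
  by apply: (mulgI (val (phi x))); rewrite -valM !mulVKg.
split.
  have -> : val ((phi x)^-1 * phi (x * h))%g = (c * SLQ h * c'^-1)%g.
    rewrite E; apply: (mulgI (val (phi x))); rewrite mulVKg !mulgA -cE -SLQM.
    by rewrite cE' mulgK.
  by apply: bounded_mulmx; [exact: bounded_mulmx|exact: bounded_SLV].
exists (a' - a), (b' - b), (- p), (- q).
exists (p * q * M%:Z - (n * M%:Z + (col x)%:Z)), p', q', (n' * M%:Z + (col (x * h)%g)%:Z).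
rewrite E xE yE invgM uniV diaV -mulgA; congr (_ * _)%g.
  congr (uni _ _ _); rewrite ?mulrNz // nE intrB mulrBl !intrM mulfK //.
by rewrite mulgA diaM [- a + _]addrC [- b + _]addrC nE.
Qed.

End Embedding.

Theorem theorem4p3 (R : realType) :
  exists G : groupType,
    [/\ finitely_generated G,
        solvable_group G
      & forall (S : seq G) (genS : generates S),
          contains_copy_of (wobbling (word_space R genS)) (SL 3 int)].
Proof.
have [M [phi [phiI phiF]]] := gamma_embedding.
exists (Gamma M); split; [exact: generated_group_fg|exact: Gamma_solvable|].
by move=> S genS; exact: wobbling_contains phiI phiF.
Qed.
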